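(* Let $(X,d)$ be a complete metric space and let $S,T:X\to CB(X)$ be a duality of generalized $\varphi$-weak contractions, i.e. $\varphi:[0,+\infty)\to[0,+\infty)$ satisfies $\varphi(0)=0$, $\varphi(t)<t$ for all $t>0$, and $H(Sx,Ty)\le\varphi(M(x,y))$ for all $x,y\in X$. Suppose that $\varphi$ is upper semicontinuous and $$\liminf_{t\to\infty}\,[t-\varphi(t)]>0 .$$ If $S$ and $T$ have the approximate endpoint property, that is, $$\inf_{x\in X}\big[H(\{x\},Sx)+H(\{x\},Tx)\big]=0,$$ then $S$ and $T$ have a unique common endpoint, i.e. there is a unique $x\in X$ with $Sx=Tx=\{x\}$.
   Context: $X$ is nonempty. $CB(X)$ is the class of nonempty closed and bounded subsets of the metric space $(X,d)$. For $x\in X$ and $A\subseteq X$, $d(x,A)=\inf_{a\in A}d(x,a)$. $H$ is the Hausdorff metric on $CB(X)$: $H(A,B)=\max\{\sup_{x\in B}d(x,A),\ \sup_{x\in A}d(x,B)\}$. For $S,T:X\to CB(X)$, put $$M(x,y)=\max\Big\{d(x,y),\ d(x,Sx),\ d(y,Ty),\ \tfrac{d(x,Ty)+d(y,Sx)}{2}\Big\}.$$ An endpoint of $T$ is a point $x\in X$ with $Tx=\{x\}$. *)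

(* Defs.v *)
From HB Require Import structures.
From mathcomp Require Import all_boot all_order all_algebra.
From mathcomp Require Import all_classical all_reals all_analysis.

Set Implicit Arguments.
Unset Strict Implicit.
Unset Printing Implicit Defensive.

Import Order.TTheory GRing.Theory Num.Theory.
Import numFieldNormedType.Exports.

Local Open Scope classical_set_scope.
Local Open Scope ring_scope.

(* Library completeness (every Cauchy proper filter converges) comes with a
   distinguished point, so these are the nonempty complete metric spaces. *)
#[short(type="completeMetricType")]
HB.structure Definition CompleteMetric (K : numDomainType) :=
  { X of Metric K X & Complete X }.

Section multivalued_maps.
Context {R : realType} {X : metricType R}.
Implicit Types (x y : X) (A B : set X) (S T : X -> set X) (phi : R -> R).

Definition metric_bounded A :=
  exists r : R, forall x y, A x -> A y -> mdist x y <= r.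

Definition CB : set (set X) :=
  [set A | [/\ A !=set0, closed A & metric_bounded A]].

(* [inf] and [sup] are real-valued; the sets below are nonempty and bounded
   when the arguments belong to [CB]. *)
Definition dist_to_set x A : R := inf [set mdist x a | a in A].

Definition hausdorff_dist A B : R :=
  Num.max (sup [set dist_to_set x A | x in B])
          (sup [set dist_to_set x B | x in A]).

Definition contraction_bound S T x y : R :=
  Num.max (mdist x y)
    (Num.max (dist_to_set x (S x))
      (Num.max (dist_to_set y (T y))
        ((dist_to_set x (T y) + dist_to_set y (S x)) / 2))).

(* A map phi : [0, +oo) -> [0, +oo) is a function on R of which only the values
   on [0, +oo) matter. *)
Definition weak_contraction_duality phi S T :=
  [/\ forall t, 0 <= t -> 0 <= phi t,
      phi 0 = 0,
      forall t, 0 < t -> phi t < t &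
      forall x y,
        hausdorff_dist (S x) (T y) <= phi (contraction_bound S T x y)].

Definition approximate_endpoint_property S T :=
  inf [set hausdorff_dist [set x] (S x) + hausdorff_dist [set x] (T x)
      | x in [set: X]] = 0.

Definition endpoint T x := T x = [set x].

End multivalued_maps.

(* Same shape as the library's [lower_semicontinuous], with respect to the
   subspace topology of A. *)
Definition upper_semicontinuous_within {R : realType} (A : set R) (f : R -> R) :=
  forall x a, A x -> f x < a -> \forall y \near within A (nbhs x), f y < a.

(* Main.v *)
(** Write a = H({x},Sx), b = H({y},Ty) and M = M(x,y). Then
    M <= d(x,y) + a + b <= phi(M) + 2(a + b), i.e. M - phi(M) <= 2(a + b).
    As t - phi(t) is lower semicontinuous, positive for t > 0 and has positive
    liminf at infinity, it is bounded away from 0 on every [eps, +oo); hence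
    almost-endpoints are close to each other, and by completeness they
    accumulate at some z. Letting y = z and x -> z in the contraction
    inequality, upper semicontinuity gives H({z},Tz) <= phi(d(z,Tz)), while
    d(z,Tz) <= H({z},Tz); so d(z,Tz) = 0 and Tz = {z}. The hypotheses being
    symmetric in S and T, also Sz = {z}. *)
Require Import Defs.
From mathcomp Require Import all_boot all_order all_algebra.
From mathcomp Require Import all_classical all_reals all_analysis.
From mathcomp Require Import lra.

Set Implicit Arguments.
Unset Strict Implicit.
Unset Printing Implicit Defensive.

Import Order.TTheory GRing.Theory Num.Theory.
Import numFieldNormedType.Exports.

Local Open Scope classical_set_scope.
Local Open Scope ring_scope.

(** * Distances to sets and Hausdorff distance from a singleton *)

Section distances.
Context {R : realType} {X : metricType R}.
Implicit Types (x y : X) (A B : set X).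

Lemma dist_to_set_ge0 x A : 0 <= dist_to_set x A.
Proof.
(* The empty set is treated apart: there [inf] takes its default value 0. *)
have [->|/set0P [a Aa]] := eqVneq A set0.
  by rewrite /dist_to_set image_set0 inf0.
by apply: lb_le_inf => [|_ [b _ <-]]; [exists (mdist x a), a|exact: mdist_ge0].
Qed.

Lemma dist_to_set_le x a A : A a -> dist_to_set x A <= mdist x a.
Proof.
move=> Aa; apply: ge_inf; last by exists a.
by exists 0 => _ [b _ <-]; exact: mdist_ge0.
Qed.

Lemma dist_to_set_adherent x A (e : R) : A !=set0 -> 0 < e ->
  exists2 a, A a & mdist x a < dist_to_set x A + e.
Proof.
move=> [a Aa] e0.
have [||_ [b Ab <-] lt_b] := @inf_lt R (mdist x @` A) (dist_to_set x A + e).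
- by exists (mdist x a), a.
- by rewrite -/(dist_to_set x A) ltrDl.
- by exists b.
Qed.

Lemma dist_to_set_triangle x y A : A !=set0 ->
  dist_to_set x A <= mdist x y + dist_to_set y A.
Proof.
move=> A0; apply/ler_addgt0Pr => e e0.
have [a Aa lt_a] := dist_to_set_adherent y A0 e0.
have := dist_to_set_le x Aa; have := metric_triangle x y a; lra.
Qed.

Lemma CB_set1 x : CB [set x].
Proof.
split; first by exists x.
  apply: accessible_closed_set1; apply: hausdorff_accessible.
  exact: metric_hausdorff.
by exists 0 => _ _ -> ->; rewrite mdistxx.
Qed.

Lemma dist_to_set_le_hausdorff x A B : CB A -> CB B -> B x ->
  dist_to_set x A <= hausdorff_dist A B.
Proof.
move=> [[a Aa] _ _] [_ _ [r Br]] Bx.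
rewrite /hausdorff_dist le_max; apply/orP; left.
apply: ub_le_sup; last by exists x.
(* [sup] bounds its elements only when they are bounded above; for y in B, d(y,A) <= d(y,a) <=
   d(y,x) + d(x,a) <= r + d(x,a). *)
exists (r + mdist x a) => _ [y By <-].
apply: (le_trans (dist_to_set_le y Aa)).
by apply: (le_trans (metric_triangle y x a)); rewrite lerD2r Br.
Qed.

Lemma hausdorff_distC A B : hausdorff_dist A B = hausdorff_dist B A.
Proof. exact: maxC. Qed.

Lemma dist_to_set1 x y : dist_to_set x [set y] = mdist x y.
Proof. by rewrite /dist_to_set image_set1 inf1. Qed.

(** H({x},A) is just the supremum of d(x,a) over A, since its other term d(x,A) lies below each
    d(x,a). *)
Lemma hausdorff_dist_set1_le x A (r : R) : CB A ->
  hausdorff_dist [set x] A <= r <-> forall a, A a -> mdist x a <= r.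
Proof.
move=> CBA; split=> [le_r a Aa|le_r].
  apply: le_trans le_r; rewrite metric_sym -dist_to_set1.
  by apply: dist_to_set_le_hausdorff => //; exact: CB_set1.
have [[a Aa] _ _] := CBA.
rewrite /hausdorff_dist ge_max image_set1 sup1.
rewrite (le_trans (dist_to_set_le x Aa)) ?le_r// andbT.
apply: ge_sup => [|_ [b Ab <-]]; first by exists (dist_to_set a [set x]), a.
by rewrite dist_to_set1 metric_sym le_r.
Qed.

Lemma mdist_le_hausdorff x a A : CB A -> A a ->
  mdist x a <= hausdorff_dist [set x] A.
Proof. by move=> CBA; move: a; apply/(hausdorff_dist_set1_le x _ CBA). Qed.

Lemma dist_to_set_le_hausdorff_set1 x A : CB A ->
  dist_to_set x A <= hausdorff_dist [set x] A.
Proof.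
move=> CBA; have [[a Aa] _ _] := CBA.
exact: le_trans (dist_to_set_le x Aa) (mdist_le_hausdorff x CBA Aa).
Qed.

Lemma hausdorff_dist_set1_ge0 x A : CB A -> 0 <= hausdorff_dist [set x] A.
Proof.
move=> CBA; apply: le_trans (dist_to_set_le_hausdorff_set1 x CBA).
exact: dist_to_set_ge0.
Qed.

(** Pass through a point of A at distance less than d(b,A) + e from b; the slack e is there because
    the infimum need not be attained. *)
Lemma mdist_le_hausdorffD x b A B : CB A -> CB B -> B b ->
  mdist x b <= hausdorff_dist [set x] A + hausdorff_dist A B.
Proof.
move=> CBA CBB Bb; apply/ler_addgt0Pr => e e0.
have [A0 _ _] := CBA.
have [a Aa lt_a] := dist_to_set_adherent b A0 e0.
have := dist_to_set_le_hausdorff CBA CBB Bb.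
have := mdist_le_hausdorff x CBA Aa.
have := metric_triangle x a b; rewrite (metric_sym a b); lra.
Qed.

End distances.

(** * Lower bounds for t - phi(t) *)

Section gap.
Context {R : realType} (phi : R -> R).

Lemma limf_einf_gap :
  (0 < limf_einf (fun t : R => (t - phi t)%:E) (pinfty_nbhs R))%E ->
  exists c m : R, 0 < c /\ forall t, m < t -> c <= t - phi t.
Proof.
rewrite limf_einfE => /ereal_sup_gt [_ [V [m [_ mV]] <-]] inf_gt0.
have le_inf t : m < t ->
    (ereal_inf [set (t - phi t)%:E | t in V] <= (t - phi t)%:E)%E.
  by move=> mt; apply: ereal_inf_lbound; exists t => //; exact: mV.
move: inf_gt0 le_inf.
(* An infimum +oo is ruled out by the finite value at m + 1. *)
case: (ereal_inf _) => [c| |//]; rewrite ?lte_fin => c0 le_inf.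
  by exists c, m; split=> // t /le_inf; rewrite lee_fin.
by have := le_inf (m + 1); rewrite ltrDl ltr01 => /(_ isT).
Qed.

(** Beyond some m the liminf gives the bound; on the segment [e,m] compactness merges local bounds
    into one. *)
Lemma gap_away_from0 :
  (forall t, 0 < t -> phi t < t) ->
  upper_semicontinuous_within `[0, +oo[ phi ->
  (0 < limf_einf (fun t : R => (t - phi t)%:E) (pinfty_nbhs R))%E ->
  forall e : R, 0 < e ->
    exists2 c, 0 < c & forall t, e <= t -> c <= t - phi t.
Proof.
move=> phi_lt usc /limf_einf_gap[c [m [c0 gap_c]]] e e0.
have : \forall d \near 0^'+, `[e, m] `<=` [set t | d < t - phi t].
  have /compact_near_coveringP/near_covering_withinP := @segment_compact R e m.
  apply=> t; rewrite /= in_itv/= => /andP[et _].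
  have t0 : 0 < t by exact: lt_le_trans et.
  (* For s near t, s > t - g and phi(s) < phi(t) + g = t - 3g, so s - phi(s) > 2g, which exceeds
     every d < g. *)
  pose g := (t - phi t) / 4.
  have g0 : 0 < g by rewrite divr_gt0// subr_gt0 phi_lt.
  have gE : phi t = t - 4 * g by rewrite /g; lra.
  have : phi t < t - 3 * g by lra.
  move=> /usc; rewrite /= in_itv/= andbT => /(_ (ltW t0)) phi_near.
  near=> s d => /=; rewrite in_itv/= => /andP[es _].
  have : phi s < t - 3 * g.
    suff : s \in `[0, +oo[ -> phi s < t - 3 * g.
      by apply; rewrite in_itv/= andbT (le_trans (ltW e0)).
    by near: s; exact: phi_near.
  have : t - g < s by near: s; apply: lt_nbhsr; lra.
  have : d < g by near: d; exact: nbhs_right_lt.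
  by lra.
move=> near_d; near (0 : R)^'+ => d.
have d0 : 0 < d by [].
exists (Num.min c d); first by rewrite lt_min c0.
move=> t et; rewrite ge_min; have [tm|mt] := leP t m; last by rewrite gap_c.
apply/orP; right; apply/ltW.
have : `[e, m] `<=` [set t | d < t - phi t] by near: d.
by apply; rewrite /= in_itv/= et.
Unshelve. all: by end_near. Qed.

End gap.

(** * Estimates for a dual pair and its endpoints *)

Section duality.
Context {R : realType} {X : metricType R}.
Implicit Types (S T : X -> set X) (phi : R -> R).

Lemma contraction_boundC S T x y :
  contraction_bound S T x y = contraction_bound T S y x.
Proof.
rewrite /contraction_bound metric_sym; congr Num.max.
by rewrite maxCA [in LHS]addrC.
Qed.

(** This transfers to [S] what is proved for [T]. *)
Lemma weak_contraction_dualityC phi S T :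
  weak_contraction_duality phi S T -> weak_contraction_duality phi T S.
Proof.
move=> [phi_ge0 phi0 phi_lt HST]; split=> // x y.
by rewrite hausdorff_distC contraction_boundC.
Qed.

Lemma mdist_le_contraction_bound S T x y :
  mdist x y <= contraction_bound S T x y.
Proof. by rewrite /contraction_bound le_max lexx. Qed.

Lemma contraction_bound_le S T x y : CB (S x) -> CB (T y) ->
  contraction_bound S T x y <=
    mdist x y + hausdorff_dist [set x] (S x) + hausdorff_dist [set y] (T y).
Proof.
move=> CBS CBT; have [S0 _ _] := CBS; have [T0 _ _] := CBT.
have := dist_to_set_triangle x y T0; have := dist_to_set_triangle y x S0.
rewrite (metric_sym y x).
have := dist_to_set_le_hausdorff_set1 x CBS.
have := dist_to_set_le_hausdorff_set1 y CBT.
have := dist_to_set_ge0 x (S x); have := dist_to_set_ge0 y (T y).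
have := mdist_ge0 x y.
by rewrite /contraction_bound !ge_max => *; do !(apply/andP; split); lra.
Qed.

Section dual_pair.
Context S T phi.
Hypotheses (CBS : forall x, CB (S x)) (CBT : forall x, CB (T x)).
Hypothesis dual : weak_contraction_duality phi S T.

Lemma contraction_bound_gap x y :
  contraction_bound S T x y - phi (contraction_bound S T x y) <=
    2 * (hausdorff_dist [set x] (S x) + hausdorff_dist [set y] (T y)).
Proof.
(* Any b in Ty links x to y: d(x,b) <= H({x},Sx) + H(Sx,Ty) and d(b,y) <= H({y},Ty). *)
have [_ _ _ /(_ x y) HST] := dual; have [[b Tb] _ _] := CBT y.
have := contraction_bound_le (CBS x) (CBT y).
have := mdist_le_hausdorffD x (CBS x) (CBT y) Tb.
have := mdist_le_hausdorff y (CBT y) Tb.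
have := metric_triangle x b y; rewrite (metric_sym b y); lra.
Qed.

Lemma hausdorff_dist_limit_le z :
  upper_semicontinuous_within `[0, +oo[ phi ->
  (forall e : R, 0 < e ->
    exists2 x, mdist z x < e & hausdorff_dist [set x] (S x) < e) ->
  hausdorff_dist [set z] (T z) <= phi (dist_to_set z (T z)).
Proof.
move=> usc approx; set D := dist_to_set z (T z).
have D0 : 0 <= D by exact: dist_to_set_ge0.
apply/ler_addgt0Pr => d d0.
have : phi D < phi D + d / 2 by lra.
move=> /usc; rewrite /= in_itv/= andbT => /(_ D0) /nbhs_ballP[r /= r0 phi_near].
(* The bound r/4 keeps M within 2e < r of D, where phi is controlled; the bound d/4 makes d(z,x) +
   H({x},Sx) < 2e <= d/2, the other d/2 being spent on phi(M). *)
pose e := Num.min (r / 4) (d / 4).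
have e0 : 0 < e by rewrite lt_min !divr_gt0.
have er : e <= r / 4 by rewrite /e ge_min lexx.
have ed : e <= d / 4 by rewrite /e ge_min lexx orbT.
have [x zx xS] := approx e e0.
have [_ _ _ /(_ x z) HST] := dual.
set M := contraction_bound S T x z in HST.
have DM : D <= M by rewrite /M /contraction_bound !le_max lexx !orbT.
(* D is one of the four terms of M; the two without Tz are below e, and the mean is below (D +
   3e)/2. *)
have MD : M <= D + 2 * e.
  have [S0 _ _] := CBS x; have [T0 _ _] := CBT z.
  have := dist_to_set_triangle x z T0; have := dist_to_set_triangle z x S0.
  have := dist_to_set_le_hausdorff_set1 x (CBS x).
  rewrite -/D (metric_sym x z) => *.
  rewrite /M /contraction_bound !ge_max -/D (metric_sym x z).
  by do !(apply/andP; split); lra.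
have phiM : phi M < phi D + d / 2.
  apply: phi_near; last by rewrite /= in_itv/= andbT; lra.
  by rewrite /ball/= ler0_norm; lra.
apply/(hausdorff_dist_set1_le _ _ (CBT z)) => b Tb.
have := mdist_le_hausdorffD x (CBS x) (CBT z) Tb.
have := metric_triangle z x b; lra.
Qed.

Lemma limit_endpoint z :
  upper_semicontinuous_within `[0, +oo[ phi ->
  (forall e : R, 0 < e ->
    exists2 x, mdist z x < e & hausdorff_dist [set x] (S x) < e) ->
  endpoint T z.
Proof.
move=> usc approx; have := hausdorff_dist_limit_le usc approx.
have := dist_to_set_le_hausdorff_set1 z (CBT z).
have [_ phi0 phi_lt _] := dual.
(* A positive distance D would give D <= H({z},Tz) <= phi(D) < D. *)
have [/phi_lt|D0 _] := ltP 0 (dist_to_set z (T z)); first by lra.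
have -> : dist_to_set z (T z) = 0.
  by apply/eqP; rewrite eq_le D0 dist_to_set_ge0.
rewrite phi0 => /(hausdorff_dist_set1_le z _ (CBT z)) Tz.
have eq_z b : T z b -> b = z.
  move=> /Tz zb; apply/esym/mdist_positivity/eqP.
  by rewrite eq_le zb mdist_ge0.
have [[b Tb] _ _] := CBT z.
by apply/seteqP; split=> [c /eq_z //|_ ->]; move: (Tb); rewrite (eq_z b Tb).
Qed.

(** At endpoints the bound on M - phi(M) is 0, whereas d(x,y) > 0 would force M > 0 and phi(M) <
    M. *)
Lemma endpoint_unique x y : endpoint S x -> endpoint T y -> x = y.
Proof.
move=> Sx Ty; have := contraction_bound_gap x y.
have H0 (u : X) : hausdorff_dist [set u] [set u] <= 0.
  by apply/(hausdorff_dist_set1_le _ _ (CB_set1 u)) => _ ->; rewrite mdistxx.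
have : hausdorff_dist [set x] (S x) <= 0 by rewrite [S x]Sx.
have : hausdorff_dist [set y] (T y) <= 0 by rewrite [T y]Ty.
have [_ _ phi_lt _] := dual => *.
apply: mdist_positivity; apply/eqP; rewrite eq_le mdist_ge0 andbT leNgt.
apply/negP => xy.
have := phi_lt _ (lt_le_trans xy (mdist_le_contraction_bound S T x y)); lra.
Qed.

End dual_pair.
End duality.

(** * Completeness and the conclusion *)

Section complete.
Context {R : realType} {X : completeMetricType R}.

(** The sublevel sets of E generate a filter, proper by the first hypothesis and Cauchy by the
    second; z is its limit. *)
Lemma small_values_limit (E : X -> R) :
  (forall e, 0 < e -> exists x, E x < e) ->
  (forall e, 0 < e -> exists2 d, 0 < d &
    forall x y, E x < d -> E y < d -> mdist x y < e) ->
  exists z, forall e, 0 < e -> exists2 x, mdist z x < e & E x < e.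
Proof.
move=> E_small E_close.
pose F := filter_from [set d : R | 0 < d] (fun d => [set x | E x < d]).
have FF : ProperFilter F.
  apply: filter_from_proper; last by move=> d /= /E_small.
  apply: filter_from_filter; first by exists 1 => /=.
  move=> c d /= c0 d0; exists (Num.min c d); first by rewrite /= lt_min c0.
  by move=> x /=; rewrite lt_min => /andP.
have : cauchy F.
  apply/cauchy_ballP => e e0; have [d d0 close] := E_close e e0.
  exists ([set x | E x < d], [set x | E x < d]); first by split; exists d.
  by move=> [x y] /= [Ex Ey]; rewrite ballEmdist; exact: close.
move=> /cauchy_cvg cvgF; exists (lim F) => e e0.
have Fball : F (ball (lim F) e) by apply: cvgF; exact: nbhsx_ballx.
have Fe : F [set x | E x < e] by exists e.
by have [x [+ Ex]] := filter_ex (filterI Fball Fe); rewrite ballEmdist; exists x.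
Qed.

End complete.

Theorem theorem4p2 (R : realType) (X : completeMetricType R)
    (S T : X -> set X) (phi : R -> R) :
  (forall x, CB (S x)) ->
  (forall x, CB (T x)) ->
  weak_contraction_duality phi S T ->
  upper_semicontinuous_within `[0, +oo[ phi ->
  (0 < limf_einf (fun t : R => (t - phi t)%:E) (pinfty_nbhs R))%E ->
  approximate_endpoint_property S T ->
  exists! x : X, endpoint S x /\ endpoint T x.
Proof.
move=> CBS CBT dual usc liminf_gt0 approx.
have [_ _ phi_lt _] := dual.
pose a x := hausdorff_dist [set x] (S x).
pose b x := hausdorff_dist [set x] (T x).
have a0 x : 0 <= a x by exact: hausdorff_dist_set1_ge0.
have b0 x : 0 <= b x by exact: hausdorff_dist_set1_ge0.
have [z zP] : exists z, forall e, 0 < e ->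
    exists2 x, mdist z x < e & a x + b x < e.
  apply: small_values_limit => e e0.
    have [||_ [x _ <-] lt_x] := @inf_lt R [set a x + b x | x in [set: X]] e.
    - by exists (a point + b point), point.
    - by rewrite approx.
    - by exists x.
  have [c c0 gap] := gap_away_from0 phi_lt usc liminf_gt0 e0.
  (* Since a(x) and b(y) are both below c/4, M - phi(M) <= 2(a(x) + b(y)) < c, which excludes M >=
     e. *)
  exists (c / 4) => [|x y Ex Ey]; first by rewrite divr_gt0.
  apply: (le_lt_trans (mdist_le_contraction_bound S T x y)).
  rewrite ltNge; apply/negP => /gap.
  have := contraction_bound_gap CBS CBT dual x y.
  rewrite -/(a x) -/(b y); have := a0 y; have := b0 x; lra.
have Sz : endpoint S z.
  (* [limit_endpoint] concludes about the second map of the pair, hence the swap. *)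
  apply: (limit_endpoint CBT CBS (weak_contraction_dualityC dual)) => // e e0.
  have [x zx abx] := zP e e0; exists x => //; rewrite -/(b x).
  by have := a0 x; lra.
have Tz : endpoint T z.
  apply: (limit_endpoint CBS CBT dual) => // e e0.
  have [x zx abx] := zP e e0; exists x => //; rewrite -/(a x).
  by have := b0 x; lra.
by exists z; split=> // y [_ Ty]; exact: (endpoint_unique CBS CBT dual Sz Ty).
Qed.
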